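(* Let $H$ be a Heyting algebra and $a\in H$. Then there exist a set $D$, a subalgebra $H[\iota]\subseteq H^D$ containing the diagonal copy of $H$ in $H^D$, a Heyting algebra $H\langle\Delta(a)\rangle$ and a surjective homomorphism $\pi:H[\iota]\to H\langle\Delta(a)\rangle$ such that, writing $\pi(h)$ for the image under $\pi$ of the diagonal (constant) element corresponding to $h\in H$: (a) the filter $\mathcal D_{\pi(a)}(H\langle\Delta(a)\rangle)$ is principal; (b) the composite homomorphism $H\hookrightarrow H[\iota]\to H\langle\Delta(a)\rangle$ (diagonal embedding followed by $\pi$) is one-to-one; (c) for every $b\in H$ such that the filter $\mathcal D_b(H)$ is principal, the filter $\mathcal D_{\pi(b)}(H\langle\Delta(a)\rangle)$ is principal as well.
   Context: For an element $a$ of a Heyting algebra $A$, $\mathcal D_a(A)=\{d\in A: a\le d \text{ and } (d\to a)=a\}$ is the set of elements dense over $a$; it is a filter of $A$. A filter is principal if it has a smallest element. $H^D$ denotes the direct power (product of $D$ copies of $H$, with pointwise operations), and the diagonal copy of $H$ consists of the constant families. *)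

(* Defs.v *)
From HB Require Import structures.
From mathcomp Require Import all_boot all_order.
From mathcomp Require Import boolp classical_sets.

Set Implicit Arguments.
Unset Strict Implicit.
Unset Printing Implicit Defensive.

Import Order.TTheory.
Local Open Scope order_scope.

(* Distributivity is not required: it follows from the adjunction. The lattice
   with a single element (\bot = \top) is allowed. *)
HB.mixin Record TBLattice_hasImp (d : Order.disp_t) T of Order.TBLattice d T := {
  imp : T -> T -> T;
  leIimp : forall x y z : T, (x `&` y <= z)%O = (x <= imp y z)%O;
}.

#[short(type="heytingType")]
HB.structure Definition Heyting (d : Order.disp_t) :=
  { T of TBLattice_hasImp d T & Order.TBLattice d T }.

Notation "x `=>` y" := (imp x y) (at level 55, right associativity) : order_scope.

HB.mixin Record isImpMorphism (d : Order.disp_t) (T : heytingType d)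
    (d' : Order.disp_t) (T' : heytingType d') (apply : T -> T') := {
  hmorph_imp : {morph apply : x y / x `=>` y};
}.

(* Order.TBLatticeMorphism only concerns \bot and \top. *)
HB.structure Definition HeytingMorphism (d : Order.disp_t) (T : heytingType d)
    (d' : Order.disp_t) (T' : heytingType d') :=
  { f of isImpMorphism d T d' T' f & @Order.LatticeMorphism d T d' T' f
       & @Order.TBLatticeMorphism d T d' T' f }.

Notation "{ 'hmorphism' T -> T' }" :=
  (@HeytingMorphism.type _ T%type _ T'%type)
  (at level 0, T at level 98, T' at level 99,
   format "{ 'hmorphism'  T  ->  T' }") : type_scope.

Section Power.
Variables (D : Type) (d : Order.disp_t) (H : heytingType d).
Implicit Types f g h : D -> H.

Fact botf_le f : (fun=> \bot) <= f.
Proof. by apply/lefP => x; apply: le0x. Qed.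

Fact lef_top f : f <= (fun=> \top).
Proof. by apply/lefP => x; apply: lex1. Qed.

HB.instance Definition _ := Order.hasBottom.Build _ (D -> H) botf_le.
HB.instance Definition _ := Order.hasTop.Build _ (D -> H) lef_top.

Fact leIimpf f g h : (f `&` g <= h) = (f <= (fun x => g x `=>` h x)).
Proof.
apply/lefP/lefP => le_fgh x; first by rewrite -leIimp; apply: le_fgh.
by rewrite meetfE leIimp; apply: le_fgh.
Qed.

HB.instance Definition _ := TBLattice_hasImp.Build _ (D -> H) leIimpf.

Definition diag (h : H) : D -> H := fun=> h.

End Power.

Arguments diag D {d H} h.

Definition imp_closed (d : Order.disp_t) (T : heytingType d) (S : {pred T}) :=
  {in S &, forall x y, x `=>` y \in S}.

HB.mixin Record isImpClosed (d : Order.disp_t) (T : heytingType d)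
    (S : {pred T}) := {
  opred_imp : imp_closed S;
}.

#[short(type="heytingClosed")]
HB.structure Definition HeytingClosed (d : Order.disp_t) (T : heytingType d) :=
  { S of isImpClosed d T S & @Order.LatticeClosed d T S
       & @Order.TBLatticeClosed d T S }.

Section Subalgebra.
Variables (d : Order.disp_t) (T : heytingType d) (S : heytingClosed T).

Definition subalgebra := {x : T | x \in S}.

HB.instance Definition _ := SubChoice.on subalgebra.
HB.instance Definition _ := [SubChoice_isTBSubLattice of subalgebra by <: with d].

Definition sub_imp (x y : subalgebra) : subalgebra :=
  exist _ (val x `=>` val y) (opred_imp _ _ (valP x) (valP y)).

Fact leIsub_imp (x y z : subalgebra) : (x `&` y <= z) = (x <= sub_imp y z).
Proof. by rewrite -!Order.le_val; exact: leIimp. Qed.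

HB.instance Definition _ := TBLattice_hasImp.Build d subalgebra leIsub_imp.

End Subalgebra.

Definition dense_over (d : Order.disp_t) (A : heytingType d) (a : A) : set A :=
  [set x | a <= x /\ x `=>` a = a]%classic.

Definition lattice_filter (d : Order.disp_t) (A : heytingType d) (F : set A) :=
  [/\ F \top, forall x y, F x -> F y -> F (x `&` y)
    & forall x y, F x -> x <= y -> F y].

Definition principal (d : Order.disp_t) (A : heytingType d) (F : set A) :=
  lattice_filter F /\ exists2 m, F m & lbound F m.

Section DenseOver.
Variables (d : Order.disp_t) (A : heytingType d).
Implicit Types x y z : A.

Lemma impA x y z : x `&` y `=>` z = x `=>` y `=>` z.
Proof.
apply/le_anti/andP; split; first by rewrite -!leIimp -meetA leIimp.
by rewrite -leIimp meetA !leIimp.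
Qed.

Lemma le_imp x y : y <= x `=>` y.
Proof. by rewrite -leIimp leIl. Qed.

Lemma dense_over_filter (a : A) : lattice_filter (dense_over a).
Proof.
split=> [|x y [ax xa] [ay ya]|x y [ax xa] xy].
- split; first exact: lex1.
  by apply/le_anti; rewrite le_imp andbT -[X in X <= _]meetx1 leIimp.
- by split; rewrite ?lexI ?ax ?ay // impA ya xa.
split; first exact: le_trans xy.
apply/le_anti; rewrite le_imp andbT -[X in _ <= X]xa -leIimp.
by apply: le_trans (leI2 (lexx _) xy) _; rewrite leIimp.
Qed.

End DenseOver.

(* Main.v *)
Require Import Defs.
From HB Require Import structures.
From mathcomp Require Import all_boot all_order.
From mathcomp Require Import boolp classical_sets.
(* [filter] has its own notation for the symbol of Heyting implication. *)
From mathcomp Require Import -(notations) filter.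

Import Order.TTheory.

(** Let [D] be the filter of elements dense over [a], and call [f : D -> H]
    coherent if [f d] and [f e] have the same meet with [d `&` e]. Coherent
    functions form a subalgebra of the power, which contains the constants and
    the inclusion [iota : D -> H]. Identify two coherent functions when they
    agree on all sufficiently small elements of [D]. Constants stay distinct,
    and a property of values, such as lying in a principal filter of [H], passes
    to the quotient; this gives (b) and (c). For (a), the class of [iota] is
    dense over that of [a]. If the values of [f] are dense over [a] below [e],
    then [f e] belongs to [D], and an [x <= e `&` f e] has the same meet with
    [f x] as with [f e], namely [x]; so [x <= f x], and the class of [iota] is
    the least one dense over that of [a]. *)

Set Implicit Arguments.
Unset Strict Implicit.
Unset Printing Implicit Defensive.

Local Open Scope order_scope.
Local Open Scope quotient_scope.

Section HeytingTheory.
Variables (d : Order.disp_t) (A : heytingType d).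
Implicit Types a u x y z : A.

Lemma imp_eq1 x y : (x `=>` y == \top) = (x <= y).
Proof. by rewrite -le1x -leIimp meet1x. Qed.

Lemma meet_imp_le x y : x `&` (x `=>` y) <= y.
Proof. by rewrite meetC leIimp. Qed.

Lemma imp_trans x y z : (x `=>` y) `&` (y `=>` z) <= x `=>` z.
Proof.
rewrite -leIimp meetC meetA; apply: le_trans (meet_imp_le y z).
by rewrite leI2 ?meet_imp_le.
Qed.

Lemma impxI x y z : x `=>` y `&` z = (x `=>` y) `&` (x `=>` z).
Proof. by apply/eqP/eq_geP => u; rewrite lexI -!leIimp lexI. Qed.

Lemma impUx x y z : x `|` y `=>` z = (x `=>` z) `&` (y `=>` z).
Proof.
by apply/eqP/eq_geP => u; rewrite lexI -!leIimp ![u `&` _]meetC !leIimp leUx.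
Qed.

Lemma heyting_meetUr : right_distributive (@Order.meet d A) (@Order.join d A).
Proof.
move=> x y z; apply/eqP/eq_leP => u.
by rewrite leUx ![x `&` _]meetC !leIimp leUx.
Qed.

Lemma meet_imp_meet u x y : u `&` (x `=>` y) = u `&` (u `&` x `=>` u `&` y).
Proof.
apply/eqP/eq_geP => z; rewrite !lexI -!leIimp lexI.
by case: (boolP (z <= u)) => // zu; rewrite meetA (meet_l zu) (leIxl _ zu).
Qed.

Lemma dense_overP a x : dense_over a x <-> a <= x /\ x `=>` a <= a.
Proof.
split=> -[ax xa]; split=> //; first by rewrite xa.
by apply/le_anti; rewrite xa le_imp.
Qed.

End HeytingTheory.

Section FilterQuotient.
Variables (d : Order.disp_t) (A : heytingType d) (F : set A).
Hypothesis filterF : lattice_filter F.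
Implicit Types x y z : A.

Lemma lattice_filterI x y : F (x `&` y) <-> F x /\ F y.
Proof.
have [_ FI Fle] := filterF; split=> [Fxy|[Fx Fy]]; last exact: FI.
by split; apply: Fle Fxy _; rewrite ?leIl ?leIr.
Qed.

Definition lemod x y := `[< F (x `=>` y) >].

Lemma le_lemod x y : x <= y -> lemod x y.
Proof.
rewrite -imp_eq1 => /eqP xy; apply/asboolP; rewrite xy.
by have [] := filterF.
Qed.

Lemma lemod_trans : transitive lemod.
Proof.
have [_ FI Fle] := filterF => y x z /asboolP Fxy /asboolP Fyz.
by apply/asboolP; apply: Fle (imp_trans x y z); apply: FI.
Qed.

Lemma lemodxI x y z : lemod x (y `&` z) = lemod x y && lemod x z.
Proof.
by rewrite /lemod impxI -asbool_and; apply/asbool_equiv_eq/lattice_filterI.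
Qed.

Lemma lemodUx x y z : lemod (x `|` y) z = lemod x z && lemod y z.
Proof.
by rewrite /lemod impUx -asbool_and; apply/asbool_equiv_eq/lattice_filterI.
Qed.

Lemma lemodIimp x y z : lemod (x `&` y) z = lemod x (y `=>` z).
Proof. by rewrite /lemod impA. Qed.

Definition equivmod x y := lemod x y && lemod y x.

Lemma equivmod_refl : reflexive equivmod.
Proof. by move=> x; rewrite /equivmod !le_lemod. Qed.

Lemma equivmod_sym : symmetric equivmod.
Proof. by move=> x y; rewrite /equivmod andbC. Qed.

Lemma equivmod_trans : transitive equivmod.
Proof.
move=> y x z /andP[xy yx] /andP[yz zy].
by rewrite /equivmod (lemod_trans xy yz) (lemod_trans zy yx).
Qed.

Canonical equivmod_equiv :=
  EquivRel equivmod equivmod_refl equivmod_sym equivmod_trans.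

Definition filter_quotient := {eq_quot equivmod_equiv}.
HB.instance Definition _ := Choice.on filter_quotient.
HB.instance Definition _ := EqQuotient.on filter_quotient.
Implicit Types X Y Z : filter_quotient.

Definition proj x : filter_quotient := \pi x.

Lemma repr_projK : cancel repr proj.
Proof. exact: reprK. Qed.

Lemma equivmod_repr x : equivmod (repr (proj x)) x.
Proof. by apply/eqmodP; rewrite reprK. Qed.

Definition le_quot X Y := lemod (repr X) (repr Y).

Lemma le_quot_refl : reflexive le_quot.
Proof. by move=> X; apply: le_lemod. Qed.

Lemma le_quot_anti : antisymmetric le_quot.
Proof. by move=> X Y XY; rewrite -[X]reprK -[Y]reprK; apply/eqmodP. Qed.

Lemma le_quot_trans : transitive le_quot.
Proof. by move=> Y X Z; apply: lemod_trans. Qed.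

HB.instance Definition _ := Order.Le_isPOrder.Build d filter_quotient
  le_quot_refl le_quot_anti le_quot_trans.

Lemma le_proj x y : (proj x <= proj y) = lemod x y.
Proof.
have /andP[rx xr] := equivmod_repr x; have /andP[ry yr] := equivmod_repr y.
apply/idP/idP => [rxy|xy]; first exact: lemod_trans xr (lemod_trans rxy ry).
exact: lemod_trans rx (lemod_trans xy yr).
Qed.

Definition meet_quot X Y := proj (repr X `&` repr Y).
Definition join_quot X Y := proj (repr X `|` repr Y).
Definition imp_quot X Y := proj (repr X `=>` repr Y).

Lemma lexI_quot X Y Z : (X <= meet_quot Y Z) = (X <= Y) && (X <= Z).
Proof. by rewrite -[X]repr_projK le_proj lemodxI -!le_proj !repr_projK. Qed.

Lemma leUx_quot X Y Z : (join_quot X Y <= Z) = (X <= Z) && (Y <= Z).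
Proof. by rewrite -[Z]repr_projK le_proj lemodUx -!le_proj !repr_projK. Qed.

HB.instance Definition _ := Order.POrder_MeetJoin_isLattice.Build d
  filter_quotient lexI_quot leUx_quot.

Lemma proj_bot_le X : proj \bot <= X.
Proof. by rewrite -[X]repr_projK le_proj le_lemod ?le0x. Qed.

Lemma le_proj_top X : X <= proj \top.
Proof. by rewrite -[X]repr_projK le_proj le_lemod ?lex1. Qed.

HB.instance Definition _ := Order.hasBottom.Build d filter_quotient proj_bot_le.
HB.instance Definition _ := Order.hasTop.Build d filter_quotient le_proj_top.

Lemma leIimp_quot X Y Z : (X `&` Y <= Z) = (X <= imp_quot Y Z).
Proof.
by rewrite -[in RHS](repr_projK X) -[in LHS](repr_projK Z) !le_proj lemodIimp.
Qed.

HB.instance Definition _ :=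
  TBLattice_hasImp.Build d filter_quotient leIimp_quot.

Lemma eq_ge_proj X Y : (forall z, (proj z <= X) = (proj z <= Y)) -> X = Y.
Proof. by move=> XY; apply/eqP/eq_geP => Z; rewrite -[Z]repr_projK. Qed.

Lemma eq_le_proj X Y : (forall z, (X <= proj z) = (Y <= proj z)) -> X = Y.
Proof. by move=> XY; apply/eqP/eq_leP => Z; rewrite -[Z]repr_projK. Qed.

Lemma proj_le : {homo proj : x y / x <= y}.
Proof. by move=> x y xy; rewrite le_proj le_lemod. Qed.

Lemma proj_meet : {morph proj : x y / x `&` y}.
Proof.
by move=> x y; apply: eq_ge_proj => z; rewrite lexI !le_proj lemodxI.
Qed.

Lemma proj_join : {morph proj : x y / x `|` y}.
Proof.
by move=> x y; apply: eq_le_proj => z; rewrite leUx !le_proj lemodUx.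
Qed.

Lemma proj_imp : {morph proj : x y / x `=>` y}.
Proof.
move=> x y; apply: eq_ge_proj => z.
by rewrite -leIimp -proj_meet !le_proj lemodIimp.
Qed.

HB.instance Definition _ := Order.isOrderMorphism.Build _ _ _ _ proj proj_le.
HB.instance Definition _ :=
  Order.isLatticeMorphism.Build _ _ _ _ proj proj_meet proj_join.
HB.instance Definition _ :=
  Order.isBLatticeMorphism.Build _ _ _ _ proj (erefl : proj \bot = \bot).
HB.instance Definition _ :=
  Order.isTLatticeMorphism.Build _ _ _ _ proj (erefl : proj \top = \top).
HB.instance Definition _ := isImpMorphism.Build _ _ _ _ proj proj_imp.

End FilterQuotient.

Section ReducedPower.
Variables (I : Type) (d : Order.disp_t) (H : heytingType d).
Variables (S : heytingClosed (I -> H)) (diagS : forall h : H, diag I h \in S).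
Variables (F : set_system I) (FF : ProperFilter F).
Implicit Types (f g : subalgebra S) (h k : H).

Definition eventually_top : set (subalgebra S) :=
  [set f : subalgebra S | F [set i | val f i = \top]]%classic.

Lemma eventually_top_filter : lattice_filter eventually_top.
Proof.
split=> [|f g|f g]; first exact: filterE.
- by apply: filterS2 => i /= fi gi; rewrite meetfE fi gi meetxx.
- move=> + fg; apply: filterS => i fi; apply/eqP; rewrite -le1x -fi.
  by move: fg; rewrite -Order.le_val => /lefP.
Qed.

Definition germ f : filter_quotient eventually_top_filter :=
  proj eventually_top_filter f.

Definition const_sub h : subalgebra S := exist _ (diag I h) (diagS h).

Definition const_germ h := germ (const_sub h).

Lemma le_germ f g :
  germ f <= germ g <-> F [set i | val f i <= val g i]%classic.
Proof.
rewrite /germ le_proj; split=> [/asboolP|fg]; last (apply/asboolP; move: fg).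
  by apply: filterS => i /=; rewrite -imp_eq1 => /eqP.
by apply: filterS => i /=; rewrite -imp_eq1 => /eqP.
Qed.

Lemma const_germ_inj : injective const_germ.
Proof.
have le_const h k : const_germ h <= const_germ k -> h <= k.
  by move=> /le_germ; apply: filter_const.
by move=> h k hk; apply/le_anti; rewrite !le_const // hk.
Qed.

Lemma dense_over_germ f h : dense_over (const_germ h) (germ f) <->
  F [set i | dense_over h (val f i)]%classic.
Proof.
have imp_germ : germ f `=>` const_germ h = germ (f `=>` const_sub h).
  by rewrite /germ proj_imp.
rewrite dense_overP imp_germ; split=> [[/le_germ + /le_germ]|f_dense].
  by apply: filterS2 => i hf fh; apply/dense_overP.
by split; apply/le_germ; apply: filterS f_dense => i /dense_overP[].
Qed.

Lemma principal_const_germ h :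
  principal (dense_over h) -> principal (dense_over (const_germ h)).
Proof.
move=> [_ [m hm m_min]]; split; first exact: dense_over_filter.
exists (const_germ m) => [|X]; first by apply/dense_over_germ; apply: filterE.
rewrite -[X]repr_projK => /dense_over_germ Xdense.
by apply/le_germ; apply: filterS Xdense => i /m_min.
Qed.

End ReducedPower.

Section CoherentFunctions.
Variables (I : Type) (d : Order.disp_t) (H : heytingType d) (w : I -> H).
Implicit Types (i j : I) (f g : I -> H).

Definition coherent : {pred I -> H} := fun f =>
  `[< forall i j, w i `&` w j `&` f i = w i `&` w j `&` f j >].

Lemma coherentP f :
  reflect (forall i j, w i `&` w j `&` f i = w i `&` w j `&` f j)
          (f \in coherent).
Proof. exact: asboolP. Qed.

Lemma coherent_diag h : diag I h \in coherent.
Proof. exact/coherentP. Qed.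

Lemma coherentI : {in coherent &, forall f g, f `&` g \in coherent}.
Proof.
move=> f g /coherentP cf /coherentP cg; apply/coherentP => i j.
by rewrite !meetfE !meetA cf meetAC cg meetAC.
Qed.

Lemma coherentU : {in coherent &, forall f g, f `|` g \in coherent}.
Proof.
move=> f g /coherentP cf /coherentP cg; apply/coherentP => i j.
by rewrite !joinfE !heyting_meetUr cf cg.
Qed.

Lemma coherent_imp : imp_closed coherent.
Proof.
move=> f g /coherentP cf /coherentP cg; apply/coherentP => i j.
by rewrite meet_imp_meet cf cg -meet_imp_meet.
Qed.

HB.instance Definition _ := Order.isTBLatticeClosed.Build _ _ coherent
  coherentI coherentU (coherent_diag \bot) (coherent_diag \top).
HB.instance Definition _ := isImpClosed.Build _ _ coherent coherent_imp.

Lemma coherent_weight : w \in coherent.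
Proof. by apply/coherentP => i j; rewrite meetAC meetxx -meetA meetxx. Qed.

Lemma weight_le_coherent f i j :
  f \in coherent -> w j <= w i `&` f i -> w j <= f j.
Proof.
move=> /coherentP cf; rewrite lexI => /andP[wji wjf].
by have := cf i j; rewrite (meet_r wji) (meet_l wjf) => ->; apply: leIr.
Qed.

Definition small_weights : set_system I :=
  filter_from [set: I] (fun i => [set j | w j <= w i])%classic.

Lemma small_weights_proper (i0 : I) :
  (forall i j, exists k, w k <= w i `&` w j) -> ProperFilter small_weights.
Proof.
move=> w_directed; apply: filter_from_proper => [|i _]; last by exists i => /=.
apply: filter_fromT_filter; first by exists i0.
move=> i j; have [k] := w_directed i j; rewrite lexI => /andP[ki kj].
by exists k => l /= lk; split; apply: le_trans lk _.
Qed.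

End CoherentFunctions.

Section DenseGerms.
Variables (d : Order.disp_t) (H : heytingType d) (a : H).
Local Notation D := {x : H | dense_over a x}.
Local Notation iota := (sval : D -> H).

#[local] Instance small_dense_proper : ProperFilter (small_weights iota).
Proof.
have [D1 DI _] := dense_over_filter a.
apply: small_weights_proper => [|[x Dx] [y Dy]]; first by exists \top.
by exists (exist _ _ (DI _ _ Dx Dy)).
Qed.

Lemma principal_const_germ_dense :
  principal
    (dense_over (const_germ (coherent_diag iota) small_dense_proper a)).
Proof.
have [_ DI _] := dense_over_filter a; split; first exact: dense_over_filter.
exists (germ small_dense_proper (exist _ iota (coherent_weight iota))) => [|X].
  by apply/dense_over_germ; apply: filterE => x; apply: svalP.
rewrite -[X]repr_projK; move: (repr X) => f /dense_over_germ[e _ f_dense].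
apply/le_germ; exists (exist _ _ (DI _ _ (svalP e) (f_dense e (lexx _)))) => //.
by move=> x /=; apply: weight_le_coherent (valP f).
Qed.

End DenseGerms.

Theorem theorem3p1 (d : Order.disp_t) (H : heytingType d) (a : H) :
  exists (D : Type) (S : heytingClosed (D -> H))
    (diagS : forall h : H, diag D h \in S)
    (d' : Order.disp_t) (K : heytingType d')
    (pi : {hmorphism subalgebra S -> K}),
    let pi_diag (h : H) : K := pi (exist _ (diag D h) (diagS h)) in
    [/\ forall y : K, exists x : subalgebra S, pi x = y,
        principal (dense_over (pi_diag a)),
        injective pi_diag
      & forall b : H, principal (dense_over b) ->
          principal (dense_over (pi_diag b))].
Proof.
pose iota : {x | dense_over a x} -> H := sval.
exists _, (HeytingClosed.clone _ _ (coherent iota) _), (coherent_diag iota).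
exists _, _, (proj (eventually_top_filter _ (small_dense_proper a))); split.
- by move=> X; exists (repr X); apply: repr_projK.
- exact: principal_const_germ_dense.
- exact: (@const_germ_inj _ _ _ _ _ _ (small_dense_proper a)).
- exact: (@principal_const_germ _ _ _ _ _ _ (small_dense_proper a)).
Qed.
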